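(* Let $\mathbb{K}$ be a field of characteristic different from $2$ and let $A=(V,\mu)$ be a $3$-dimensional skew-symmetric $\mathbb{K}$-algebra. Then $A$ is a Lie algebra if and only if there exists a nonzero vector $X\in V$ such that the linear endomorphism $L_X:V\to V$, $L_X(Y)=\mu(X,Y)$, is in the kernel of $M_\mu$ (i.e. $M_\mu\cdot{}^tv_{L_X}=0$).
   Context: A skew-symmetric $\mathbb{K}$-algebra is a vector space $V$ with a bilinear map $\mu:V\times V\to V$ satisfying $\mu(X,Y)=-\mu(Y,X)$. Fix a basis $\{e_1,e_2,e_3\}$ of $V$. For $f\in \mathrm{End}(V)$ put $\delta_\mu f(X,Y)=\mu(f(X),Y)+\mu(X,f(Y))-f(\mu(X,Y))$. If $f$ has matrix $(f_{ij})$ in the basis, let $v_f=(f_{1,1},f_{2,1},f_{3,1},f_{1,2},f_{2,2},f_{3,2},f_{1,3},f_{2,3},f_{3,3})\in\mathbb{K}^9$. The matrix $M_\mu$ is the $9\times 9$ matrix determined by the requirement that for every $f$, the product $M_\mu\cdot{}^tv_f$ is the column vector in $\mathbb{K}^9$ obtained by stacking the coordinate columns of $\delta_\mu f(e_1,e_2)$, $\delta_\mu f(e_1,e_3)$, $\delta_\mu f(e_2,e_3)$. An endomorphism $f$ is said to be in the kernel of $M_\mu$ if $M_\mu\cdot{}^tv_f=0$. *)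

(* Defs.v *)
From HB Require Import structures.
From mathcomp Require Import all_boot all_order all_algebra.

Set Implicit Arguments.
Unset Strict Implicit.
Unset Printing Implicit Defensive.

Import GRing.Theory.
Local Open Scope ring_scope.

Section Defs.

Variables (K : fieldType) (V : vectType K).
Implicit Types (mu : {bilinear V -> V -> V}) (f : 'End(V)) (e : 3.-tuple V).

Definition skew_symmetric mu : Prop := forall X Y : V, mu X Y = - mu Y X.

Definition jacobi_identity mu : Prop :=
  forall X Y Z : V, mu X (mu Y Z) + mu Y (mu Z X) + mu Z (mu X Y) = 0.

Definition is_Lie_algebra mu : Prop :=
  (forall X : V, mu X X = 0) /\ jacobi_identity mu.

Definition left_mul mu (X : V) : 'End(V) := linfun (mu X).

Definition delta mu f (X Y : V) : V := mu (f X) Y + mu X (f Y) - f (mu X Y).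

(* The coordinate columns, in the basis e, of the three vectors of s, stacked
   from top to bottom: row k holds coordinate k %% 3 of the vector number
   k %/ 3, everything being numbered from 0. *)
Definition stack3 e (s : seq V) : 'cV[K]_9 :=
  \col_(k < 9) coord e (inord (k %% 3)) s`_(k %/ 3).

(* The columns of the matrix of f are the coordinates of the f e`_j. *)
Definition vec_endo e f : 'cV[K]_9 := stack3 e [:: f e`_0; f e`_1; f e`_2].

Definition delta_col mu e f : 'cV[K]_9 :=
  stack3 e [:: delta mu f e`_0 e`_1;
               delta mu f e`_0 e`_2;
               delta mu f e`_1 e`_2].

(* The endomorphism with vec_endo equal to the k-th unit vector: it sends
   e`_(k %/ 3) to e`_(k %% 3) and the other basis vectors to 0. *)
Definition unit_endo e (k : 'I_9) : 'End(V) :=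
  linfun (fun x : V => coord e (inord (k %/ 3)) x *: e`_(k %% 3)).

(* By M_muP and M_mu_uniq below, this is the only matrix M such that
   M *m vec_endo e f = delta_col mu e f for every f. *)
Definition M_mu mu e : 'M[K]_9 :=
  \matrix_(r, k) delta_col mu e (unit_endo e k) r 0.

Definition in_ker_M mu e f : Prop := M_mu mu e *m vec_endo e f = 0.

Lemma left_mulE mu X Y : left_mul mu X Y = mu X Y.
Proof. by rewrite lfunE. Qed.

Lemma unit_endoE e k x :
  unit_endo e k x = coord e (inord (k %/ 3)) x *: e`_(k %% 3).
Proof.
pose g (x : V) : V := coord e (inord (k %/ 3)) x *: e`_(k %% 3).
have g_lin : linear g.
  by move=> a u v; rewrite /g linearP scalerDl scalerA.
pose gM := GRing.isLinear.Build K V V *:%R g g_lin.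
pose gL : {linear V -> V} := HB.pack g gM.
exact: (lfunE gL).
Qed.

Lemma vec_unit_endo e k :
  basis_of fullv e -> vec_endo e (unit_endo e k) = delta_mx k 0.
Proof.
move=> he; apply/colP => i; rewrite !mxE eqxx andbT.
have fe : free e by apply: basis_free he.
have cE (m n : nat) : (m < 3)%N -> (n < 3)%N ->
    coord e (inord m) e`_n = (m == n)%:R.
  move=> hm hn; have := coord_free (inord n) (inord m) fe.
  by rewrite -val_eqE /= !inordK // => ->; rewrite eq_sym.
have i3 : (i %/ 3 < 3)%N by rewrite ltn_divLR.
have k3 : (k %/ 3 < 3)%N by rewrite ltn_divLR.
have -> : [:: unit_endo e k e`_0; unit_endo e k e`_1;
    unit_endo e k e`_2]`_(i %/ 3) = unit_endo e k e`_(i %/ 3).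
  by case: (i %/ 3)%N i3 => [|[|[|]]].
rewrite unit_endoE linearZ /= !cE ?ltn_pmod // -natrM mulnb; congr (_%:R).
rewrite -val_eqE /= (divn_eq i 3) (divn_eq k 3).
have := i3; have := k3; have := ltn_pmod i (isT : (0 < 3)%N).
have := ltn_pmod k (isT : (0 < 3)%N).
move: (i %/ 3)%N (k %/ 3)%N (i %% 3)%N (k %% 3)%N.
by do 4 case=> [|[|[|?]]] //.
Qed.

Lemma endo_decomp e f : basis_of fullv e ->
  f = \sum_k vec_endo e f k 0 *: unit_endo e k.
Proof.
move=> he; apply/lfunP => x; rewrite sum_lfunE.
have expand y : y = \sum_(i < 3) coord e i y *: e`_i.
  by apply: coord_basis he _; rewrite memvf.
rewrite {1}(expand x) linear_sum /=.
under eq_bigr => j _ do rewrite linearZ /= (expand (f e`_j)).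
under [in RHS]eq_bigr => k _ do
  rewrite scale_lfunE unit_endoE scalerA mxE /=.
rewrite !big_ord_recl !big_ord0 /= !addr0 !scalerDr !scalerA.
have -> : inord 0 = 0%R :> 'I_3 by apply: val_inj; rewrite /= inordK.
have -> : inord 1 = lift ord0 ord0 :> 'I_3 by apply: val_inj; rewrite /= inordK.
have -> : inord 2 = lift ord0 (lift ord0 ord0) :> 'I_3
  by apply: val_inj; rewrite /= inordK.
by rewrite -!addrA; do ! congr (_ + _); congr (_ *: _); rewrite mulrC.
Qed.

Lemma delta_sum mu n (a : 'I_n -> K) (F : 'I_n -> 'End(V)) X Y :
  delta mu (\sum_i a i *: F i) X Y = \sum_i a i *: delta mu (F i) X Y.
Proof.
rewrite /delta !sum_lfunE linear_sumlz linear_sumr -sumrN -!big_split /=.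
apply: eq_bigr => i _.
by rewrite !scale_lfunE linearZl_LR linearZr_LR /= scalerBr scalerDr.
Qed.

Lemma M_muP mu e f : basis_of fullv e ->
  M_mu mu e *m vec_endo e f = delta_col mu e f.
Proof.
move=> he; rewrite {2}(endo_decomp f he); apply/colP => r; rewrite 2!mxE.
have r3 : (r %/ 3 < 3)%N by rewrite ltn_divLR.
under eq_bigr => k _ do rewrite 2!mxE mulrC.
by case: (r %/ 3)%N r3 => [|[|[|]]] //= _;
  rewrite delta_sum linear_sum /=; apply: eq_bigr => k _; rewrite linearZ.
Qed.

Lemma M_mu_uniq mu e (M : 'M[K]_9) : basis_of fullv e ->
  (forall f, M *m vec_endo e f = delta_col mu e f) -> M = M_mu mu e.
Proof.
move=> he hM; apply/matrixP => r k; rewrite mxE -hM vec_unit_endo //.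
by rewrite -colE mxE.
Qed.

End Defs.

(* Main.v *)
Require Import Defs.
From mathcomp Require Import all_boot all_order all_algebra.
Import GRing.Theory.
Local Open Scope ring_scope.

(** In dimension 3 the Jacobiator of a skew-symmetric product is an alternating
    trilinear map, hence determined by its value [J] at the basis. Since
    [delta (L_X) (Y, Z)] is minus the Jacobiator at [(X, Y, Z)], the endomorphism
    [L_X] is in the kernel of [M_mu] iff the Jacobiator vanishes on [X] and any
    pair of basis vectors; these values are, up to sign, the coordinates of [X]
    times [J], so a nonzero such [X] forces [J = 0]. *)

Section Jacobiator.

Set Implicit Arguments.
Unset Strict Implicit.

Variables (K : fieldType) (V : vectType K) (mu : {bilinear V -> V -> V}).
Hypothesis mu_skew : skew_symmetric mu.

Definition jacobiator (X Y Z : V) : V :=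
  mu X (mu Y Z) + mu Y (mu Z X) + mu Z (mu X Y).

(** Skew-symmetry gives [2 *: mu X X = 0]; this is the one point where the characteristic enters. *)
Lemma skew_mul_self (charK : 2%N \notin [pchar K]) X : mu X X = 0.
Proof.
have h2 : (2%:R : K) != 0 by move: charK; rewrite inE /=.
have /eqP : (2%:R : K) *: mu X X = 0.
  by rewrite scaler_nat mulr2n {1}mu_skew addNr.
by rewrite scaler_eq0 (negbTE h2) => /eqP.
Qed.

Lemma jacobiator_rot X Y Z : jacobiator X Y Z = jacobiator Y Z X.
Proof. by rewrite /jacobiator -addrA addrC. Qed.

Lemma jacobiator_swap X Y Z : jacobiator Y X Z = - jacobiator X Y Z.
Proof.
rewrite /jacobiator (mu_skew X Z) (mu_skew Z Y) (mu_skew Y X) !linearNr !opprD.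
by rewrite [- mu Y _ + _]addrC.
Qed.

Lemma jacobiator_diag X Z : mu X X = 0 -> jacobiator X X Z = 0.
Proof.
by move=> muXX; rewrite /jacobiator (mu_skew X Z) muXX linear0r linearNr addNr addr0.
Qed.

Lemma jacobiator_sum n (c : 'I_n -> K) (F : 'I_n -> V) Y Z :
  jacobiator (\sum_i c i *: F i) Y Z = \sum_i c i *: jacobiator (F i) Y Z.
Proof.
rewrite /jacobiator linear_sumr !linear_sumlz !linear_sumr -!big_split /=.
apply: eq_bigr => i _.
by rewrite !(linearZl_LR, linearZr_LR) /= !scalerDr.
Qed.

(** [delta mu f] measures how far [f] is from being a derivation, so the Jacobi identity amounts to
    every left multiplication being a derivation. *)
Lemma delta_left_mul X Y Z :
  delta mu (left_mul mu X) Y Z = - jacobiator X Y Z.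
Proof.
rewrite /delta !left_mulE /jacobiator (mu_skew Z X) linearNr.
by rewrite (mu_skew _ Z) !opprD opprK [RHS]addrC [- mu X _ + _]addrC addrA.
Qed.

End Jacobiator.

Section Basis.

Set Implicit Arguments.
Unset Strict Implicit.

Variables (K : fieldType) (V : vectType K) (e : 3.-tuple V).
Hypothesis e_basis : basis_of {:V} e.

Lemma coord_expand X : X = \sum_(i < 3) coord e i X *: e`_i.
Proof. by apply: coord_basis e_basis _; rewrite memvf. Qed.

Lemma coord_eq0 X : (forall i, coord e i X = 0) -> X = 0.
Proof.
by move=> X0; rewrite (coord_expand X) big1 // => i _; rewrite X0 scale0r.
Qed.

Lemma stack3_eq0 u v w :
  stack3 e [:: u; v; w] = 0 <-> [/\ u = 0, v = 0 & w = 0].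
Proof.
split=> [/colP s0|[-> -> ->]]; last first.
  (* A quotient [k %/ 3] beyond 2 would read the default value 0 of [nth], so no bound on it is
     needed here. *)
  by apply/colP => k; rewrite !mxE; case: (k %/ 3)%N => [|[|[|m]]];
    rewrite /= ?nth_nil linear0.
have nth0 (m : nat) : (m < 3)%N -> [:: u; v; w]`_m = 0.
  move=> m3; apply: coord_eq0 => i.
  (* Coordinate [i] of vector number [m] sits in row [m * 3 + i]. *)
  have k9 : (m * 3 + i < 9)%N.
    by rewrite -addnS (leq_trans (leq_add (leqnn _) (ltn_ord i))) // -mulSnr
      (@leq_mul _ _ 3 3).
  have := s0 (Ordinal k9); rewrite !mxE /= divnMDl // modnMDl.
  by rewrite divn_small // modn_small // addn0 inord_val.
by split; [exact: (nth0 0) | exact: (nth0 1) | exact: (nth0 2)].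
Qed.

Variable mu : {bilinear V -> V -> V}.
Hypothesis mu_skew : skew_symmetric mu.

Local Notation J := (jacobiator mu).

Lemma in_ker_M_left_mul X :
  in_ker_M mu e (left_mul mu X) <->
  [/\ J X e`_0 e`_1 = 0, J X e`_0 e`_2 = 0 & J X e`_1 e`_2 = 0].
Proof.
rewrite /in_ker_M M_muP //; apply: (iff_trans (stack3_eq0 _ _ _)).
rewrite !delta_left_mul //.
by split=> -[/eqP h1 /eqP h2 /eqP h3]; split; apply/eqP;
  rewrite ?oppr_eq0 // -oppr_eq0.
Qed.

Hypothesis mu_self : forall X, mu X X = 0.

Lemma jacobiator_basis_eq0 :
  J e`_0 e`_1 e`_2 = 0 -> forall X Y Z, J X Y Z = 0.
Proof.
move=> J0.
have first_arg Y Z :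
    (forall i : 'I_3, J e`_i Y Z = 0) -> forall X, J X Y Z = 0.
  by move=> h X; rewrite (coord_expand X) jacobiator_sum big1 // => i _;
    rewrite h scaler0.
have diag X Z : J X X Z = 0 by apply: jacobiator_diag.
have diag' X Z : J X Z X = 0 by rewrite -jacobiator_rot diag.
have diag'' X Z : J Z X X = 0 by rewrite jacobiator_rot diag.
have J1 : J e`_1 e`_2 e`_0 = 0 by rewrite -jacobiator_rot.
have J2 : J e`_2 e`_0 e`_1 = 0 by rewrite jacobiator_rot.
have swap X Y Z : J X Y Z = 0 -> J Y X Z = 0.
  by move=> h; rewrite jacobiator_swap // h oppr0.
(* Linearity is only available in the first slot: rotating after each use brings [Y], then [Z],
   there, and leaves [J e_k e_i e_j]. *)
move=> X Y Z; apply: (first_arg) => i; rewrite jacobiator_rot.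
apply: (first_arg) => j; rewrite jacobiator_rot.
apply: (first_arg) => k.
(* Of the 27 triples, those with a repeated index vanish by the [diag] facts, the even permutations
   by [J0], [J1], [J2], and the odd ones reduce to these by [swap]. *)
by case: i j k => -[|[|[|//]]] ? [[|[|[|//]]] ?] [[|[|[|//]]] ?] /=;
  rewrite ?diag ?diag' ?diag'' //; apply: swap.
Qed.

Lemma jacobiator_ker_eq0 (X : V) : X != 0 ->
  [/\ J X e`_0 e`_1 = 0, J X e`_0 e`_2 = 0 & J X e`_1 e`_2 = 0] ->
  J e`_0 e`_1 e`_2 = 0.
Proof.
move=> X_neq0 [h01 h02 h12]; apply/eqP; apply: contraNT X_neq0 => Jn0.
have diag Y Z : J Y Y Z = 0 by apply: jacobiator_diag.
have diag' Y Z : J Y Z Y = 0 by rewrite -jacobiator_rot diag.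
have coef c : c *: J e`_0 e`_1 e`_2 = 0 -> c = 0.
  by move=> /eqP; rewrite scaler_eq0 (negbTE Jn0) orbF => /eqP.
have expand Y Z : J X Y Z = coord e 0 X *: J e`_0 Y Z
    + (coord e (lift ord0 ord0) X *: J e`_1 Y Z
       + coord e (lift ord0 (lift ord0 ord0)) X *: J e`_2 Y Z).
  by rewrite {1}(coord_expand X) jacobiator_sum !big_ord_recl big_ord0 addr0.
(* In each expansion the pair of basis vectors kills two of the three terms, so [h12], [h02], [h01]
   isolate coordinates 0, 1, 2 of [X] in turn. *)
have c0 : coord e 0 X = 0.
  by apply: coef; rewrite -[RHS]h12 expand diag diag' !scaler0 !addr0.
have c1 : coord e (lift ord0 ord0) X = 0.
  (* The order (1, 0, 2) is an odd permutation, hence the sign. *)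
  apply: coef; apply: oppr_inj; rewrite oppr0 -[RHS]h02 expand diag diag'.
  by rewrite [J e`_1 _ _]jacobiator_swap // scalerN !scaler0 add0r addr0.
have c2 : coord e (lift ord0 (lift ord0 ord0)) X = 0.
  apply: coef; rewrite -[RHS]h01 expand diag diag' !scaler0 !add0r.
  by rewrite [J e`_2 _ _]jacobiator_rot.
apply/eqP; rewrite (coord_expand X) !big_ord_recl big_ord0 /=.
by rewrite c0 c1 c2 !scale0r !addr0.
Qed.

End Basis.

Theorem proposition3 (K : fieldType) (charK : 2%N \notin [pchar K])
    (V : vectType K) (e : 3.-tuple V) (e_basis : basis_of {:V} e)
    (mu : {bilinear V -> V -> V}) (mu_skew : skew_symmetric mu) :
  is_Lie_algebra mu <-> exists X : V, X != 0 /\ in_ker_M mu e (left_mul mu X).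
Proof.
have mu_self X : mu X X = 0 by apply: skew_mul_self.
split=> [[_ jac]|[X [X_neq0 /(in_ker_M_left_mul e_basis mu_skew) ker_X]]].
  (* Under the Jacobi identity any nonzero vector would do; a basis vector is one. *)
  exists e`_0; split; last by apply/(in_ker_M_left_mul e_basis mu_skew); split; apply: jac.
  by rewrite (free_not0 (basis_free e_basis)) // mem_nth ?size_tuple.
split=> // Y Z T; apply: (jacobiator_basis_eq0 e_basis) => //.
by apply: (jacobiator_ker_eq0 e_basis) ker_X.
Qed.
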